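(* For every integer $d \ge 3$ there are functions $g(d)$ and $f(d)$ with $g(d) \ge \frac{d}{2\log(d+1)}$ and $f(d) \le d!\, d$ such that for every $n \ge d$, the smallest $d$-hitting family of schedules for the antichain $\mathcal{A}_n$ on $n$ elements has size at least $g(d)\log n - O(1)$ and at most $f(d)\log n$ (logarithms to base $2$; the $O(1)$ term depends only on $d$).
   Context: The antichain $\mathcal{A}_n$ is the partial order on $n$ elements $v_1,\dots,v_n$ in which any two distinct elements are incomparable; its schedules are all $n!$ permutations of $v_1,\dots,v_n$. A $d$-tuple is a tuple $(a_1,\dots,a_d)$ of distinct elements; for an antichain every $d$-tuple is admissible. A schedule (permutation) hits $(a_1,\dots,a_d)$ if its restriction to $\{a_1,\dots,a_d\}$ is the sequence $a_1,\dots,a_d$. A family of schedules is $d$-hitting if every $d$-tuple is hit by some schedule in the family. *)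

(* Defs.v *)
From mathcomp Require Import all_boot all_order all_fingroup all_algebra.
From mathcomp Require Import reals exp.

Set Implicit Arguments.
Unset Strict Implicit.
Unset Printing Implicit Defensive.

Import GRing.Theory.

(* The elements of the antichain are the ordinals i : 'I_n. A permutation     *)
(* s : 'S_n is read as the schedule s 0, s 1, ..., s (n - 1), so s i is the   *)
(* element that is executed at time i.                                        *)
Definition schedule_seq (n : nat) (s : 'S_n) : seq 'I_n :=
  [seq s i | i <- enum 'I_n].

Definition hits (n d : nat) (s : 'S_n) (a : d.-tuple 'I_n) : bool :=
  [seq x <- schedule_seq s | x \in a] == a :> seq 'I_n.

Definition hitting (n d : nat) (F : {set 'S_n}) : bool :=
  [forall a : d.-tuple 'I_n, uniq a ==> [exists s in F, hits s a]].

(* The default value [set: 'S_n] is itself d-hitting (hittingT), so the       *)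
(* arg min is a genuine minimum; see hitting_numberP.                         *)
Definition hitting_number (n d : nat) : nat :=
  #|[arg min_(F < [set: 'S_n] | hitting d F) #|F| ]|.

Definition log2 (R : realType) (x : R) : R := (ln x / ln 2)%R.

Lemma hittingT (n d : nat) : hitting d [set: 'S_n].
Proof.
apply/forallP => a; apply/implyP => ua.
pose t := a ++ [seq x <- enum 'I_n | x \notin a].
have ut : uniq t.
  rewrite cat_uniq ua filter_uniq ?enum_uniq // andbT /=.
  by apply/hasPn => x; rewrite mem_filter => /andP[].
have mt x : x \in t.
  by rewrite mem_cat mem_filter mem_enum andbT orbN.
have st : size t = n.
  have /perm_size -> : perm_eq t (enum 'I_n).
    by apply: uniq_perm; rewrite ?enum_uniq // => x; rewrite mt mem_enum.
  by rewrite size_enum_ord.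
have injt : injective (fun i : 'I_n => nth i t i).
  move=> i j; rewrite (set_nth_default i j) ?st // => /eqP.
  by rewrite nth_uniq ?st // => /eqP/val_inj.
apply/existsP; exists (perm injt); rewrite inE /=.
have seqt : schedule_seq (perm injt) = t.
  rewrite /schedule_seq; case: (posnP n) => [n0|n_gt0].
    have t0 : t = [::] by apply: size0nil; rewrite st n0.
    by rewrite [RHS]t0; apply: size0nil; rewrite size_map size_enum_ord n0.
  apply: (@eq_from_nth _ (Ordinal n_gt0)); rewrite size_map size_enum_ord ?st //.
  move=> i lt_in; rewrite (nth_map (Ordinal n_gt0)) ?size_enum_ord // permE.
  by rewrite nth_enum_ord // (set_nth_default (Ordinal n_gt0)) ?st.
rewrite /hits seqt filter_cat.
have -> : [seq x <- [seq x <- enum 'I_n | x \notin a] | x \in a] = [::].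
  rewrite -filter_predI -(filter_pred0 (enum 'I_n)).
  by apply: eq_filter => x /=; rewrite andbN.
rewrite cats0.
by apply/eqP/all_filterP/allP.
Qed.

Lemma hitting_numberP (n d : nat) :
  (exists2 F : {set 'S_n}, hitting d F & #|F| = hitting_number n d) /\
  (forall F : {set 'S_n}, hitting d F -> hitting_number n d <= #|F|).
Proof.
rewrite /hitting_number; case: arg_minnP; first exact: hittingT.
by move=> F hF minF; split; first exists F.
Qed.

(* Main.v *)
(** Lower bound: fix an element b, let m be the integer part of (d - 1) / 2 and
cut a hitting family of size N into m blocks of at most N / m + 1 schedules.
Recording on which side of b an element falls in each schedule of a block gives
at most 2^(N/m+1) patterns, so if n is larger than this (plus d) there are, for
every block i, two elements x_i, y_i that no schedule of the block separates by
b. Then no schedule hits x_1, ..., x_m, b, y_1, ..., y_m. Hence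
N >= m log n - O(1), and m >= d / (2 log (d + 1)) since log (d + 1) >= 2.

Upper bound: a d-tuple is hit by a fraction at least 1 / d! of all schedules, so
some schedule hits at least this fraction of any set of d-tuples. Choosing
schedules greedily leaves at most (1 - 1 / d!)^k n^d < 1 tuples unhit after
k = floor (d! d log n) steps; the slack between log to base 2 and ln absorbs the
rounding. *)

Require Import Defs.
From mathcomp Require Import all_boot all_order all_fingroup all_algebra.
From mathcomp Require Import primitive_action alt zify lra.
From mathcomp Require Import reals sequences exp.
Set Implicit Arguments.
Unset Strict Implicit.
Unset Printing Implicit Defensive.
Import Order.TTheory GRing.Theory Num.Theory.

(** * Schedules as linear orders, and their symmetry *)

(** [s] maps times to elements, so [s^-1] gives the time at which an element is executed. *)
Definition before (n : nat) (s : 'S_n) : rel 'I_n :=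
  [rel x y | (s^-1)%g x < (s^-1)%g y].

Lemma before_trans (n : nat) (s : 'S_n) : transitive (before s).
Proof. by move=> y x z; apply: ltn_trans. Qed.

(** The schedule is itself sorted for [before s], and so is any filtered part of it; a sequence
    sorted for a strict order is determined by its members. *)
Lemma hitsE (n d : nat) (s : 'S_n) (a : d.-tuple 'I_n) :
  hits s a = sorted (before s) a.
Proof.
have sched_sorted : sorted (before s) (schedule_seq s).
  rewrite /schedule_seq sorted_map.
  rewrite (@eq_sorted _ _ (relpre val ltn)); last first.
    by move=> i j; rewrite /before /= !permK.
  by rewrite -sorted_map val_enum_ord iota_ltn_sorted.
have mem_sched x : x \in schedule_seq s.
  by apply/mapP; exists ((s^-1)%g x); rewrite ?mem_enum ?permKV.
have filter_sorted := sorted_filter (@before_trans n s) (mem a) sched_sorted.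
apply/eqP/idP => [<- // | a_sorted].
apply: (irr_sorted_eq (@before_trans n s)) => //.
- by move=> x; rewrite /before /= ltnn.
- by move=> x; rewrite mem_filter mem_sched andbT.
Qed.

(** The symmetric group acts [n]-transitively on ['I_n], hence [d]-transitively for [d <= n]. *)
Lemma uniq_perm_tuple (n d : nat) (a b : d.-tuple 'I_n) :
  uniq a -> uniq b -> exists e : 'S_n, map_tuple e a = b.
Proof.
move=> ua ub.
have le_dn : d <= #|'I_n|.
  by rewrite -(size_tuple a) -(card_uniqP ua) max_card.
have tr := ntransitive_weak le_dn (Sym_trans 'I_n).
have da : a \in d.-dtuple(setT) by rewrite inE ua; apply/subsetP => x; rewrite inE.
have db : b \in d.-dtuple(setT) by rewrite inE ub; apply/subsetP => x; rewrite inE.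
have [e _ ->] := atransP2 tr da db.
by exists e; apply: val_inj.
Qed.

Lemma hits_mulg (n d : nat) (s e : 'S_n) (a : d.-tuple 'I_n) :
  hits (s * e)%g (map_tuple e a) = hits s a.
Proof.
rewrite !hitsE sorted_map; apply: eq_sorted => x y.
by rewrite /before /= !invMg !permM !permK.
Qed.

Lemma sum_hits_eq (n d : nat) (a b : d.-tuple 'I_n) :
  uniq a -> uniq b -> \sum_(s : 'S_n) hits s a = \sum_(s : 'S_n) hits s b.
Proof.
move=> ua ub; have [e <-] := uniq_perm_tuple ua ub.
rewrite [RHS](reindex_inj (mulIg e)) /=.
by apply: eq_bigr => s _; rewrite hits_mulg.
Qed.

(* Every schedule hits one of the [d!] reorderings of [a], and by symmetry
   each reordering is hit equally often. *)
Lemma fact_le_sum_hits (n d : nat) (a : d.-tuple 'I_n) :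
  uniq a -> n`! <= d`! * \sum_(s : 'S_n) hits s a.
Proof.
move=> ua; pose ap (p : 'S_d) := [tuple tnth a (p i) | i < d].
have uap p : uniq (ap p).
  rewrite map_inj_uniq ?enum_uniq // => i j.
  by move/tuple_uniqP: ua => inj /inj /perm_inj.
have -> : d`! * \sum_(s : 'S_n) hits s a
        = \sum_(p : 'S_d) \sum_(s : 'S_n) hits s (ap p).
  under [RHS]eq_bigr => p _ do rewrite (sum_hits_eq (uap p) ua).
  by rewrite sum_nat_const card_Sn.
rewrite exchange_big /= -[n`!]card_Sn -sum1_card; apply: leq_sum => s _.
have [p ap_sorted] : exists p, hits s (ap p).
  pose le_s : rel 'I_n := [rel x y | (s^-1)%g x <= (s^-1)%g y].
  have /tuple_permP[p Ep] : perm_eq (sort le_s a) a by rewrite perm_sort.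
  exists p; rewrite hitsE -[tval (ap p)]Ep.
  (* Sorting only gives the weak order; distinctness of the entries makes it strict. *)
  have le_s_tot : total le_s by move=> x y; apply: leq_total.
  have : uniq (sort le_s a) by rewrite sort_uniq.
  have := sort_sorted le_s_tot a; case: (sort le_s a) => //= x t.
  elim: t x => //= y t IH x /andP[le_xy pt] /andP[x_notin ut].
  rewrite IH // andbT /before /= ltn_neqAle [X in _ && X]le_xy andbT.
  apply: contraNneq x_notin => /val_inj/perm_inj ->; exact: mem_head.
by rewrite (bigD1 p) //= ap_sorted.
Qed.

(** * Greedy construction for the upper bound *)

(** Averaging: if every schedule fell short, double counting the pairs of a schedule and a tuple of
    [U] that it hits would contradict [fact_le_sum_hits]. *)
Lemma exists_frequent_hit (n d : nat) (U : {set d.-tuple 'I_n}) :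
  {in U, forall a, uniq (val a)} ->
  exists s : 'S_n, #|U| <= d`! * #|[set a in U | hits s a]|.
Proof.
move=> uU; case: (pickP (fun s : 'S_n => #|U| <= d`! * #|[set a in U | hits s a]|)).
  by move=> s Hs; exists s.
move=> noS; exfalso.
have : \sum_(s : 'S_n) (d`! * #|[set a in U | hits s a]| + 1) <= \sum_(s : 'S_n) #|U|.
  by apply: leq_sum => s _; rewrite addn1 ltnNge noS.
rewrite big_split /= !sum_nat_const muln1 card_Sn.
rewrite leqNgt => /negP; apply; rewrite -[X in X < _]addn0 -addnS.
apply: leq_add; last exact: fact_gt0.
rewrite -big_distrr /=.
under eq_bigr => s _ do rewrite -sum1dep_card big_mkcondr /=.
rewrite exchange_big big_distrr /= mulnC -sum_nat_const; apply: leq_sum => a aU.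
apply: leq_trans (fact_le_sum_hits (uU a aU)) _.
by rewrite leq_mul2l orbC; apply/orP; left; apply: leq_sum => s _; case: hits.
Qed.

Definition unhit (n d : nat) (F : {set 'S_n}) : {set d.-tuple 'I_n} :=
  [set a : d.-tuple 'I_n | uniq a & ~~ [exists s in F, hits s a]].

(** Each greedy step shrinks the unhit set by a factor of at most [1 - 1 / d!]; denominators are
    cleared to stay in [nat]. *)
Lemma greedy_cover (n d k : nat) :
  exists2 F : {set 'S_n}, #|F| <= k
    & d`! ^ k * #|unhit d F| <= (d`!).-1 ^ k * n ^ d.
Proof.
elim: k => [|k [F leFk leU]].
  exists set0; first by rewrite cards0.
  by rewrite !expn0 !mul1n -[X in X ^ d]card_ord -card_tuple max_card.
set U := unhit d F in leU.
have [|s leUs] := @exists_frequent_hit n d U; first by move=> a; rewrite inE => /andP[].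
exists (s |: F).
  by rewrite cardsU1; case: (_ \notin _); rewrite ?add1n ?add0n // ltnW.
set V := unhit d (s |: F).
have cardU : #|U| = #|[set a in U | hits s a]| + #|V|.
  rewrite -(cardsID [set a | hits s a] U); congr (_ + _); apply: eq_card => a.
    by rewrite !inE.
  rewrite !inE; case: (boolP (uniq a)) => _ /=; last by rewrite andbF.
  apply/andP/negP => [[Na NF] /existsP[r /andP[]] | NV].
    rewrite !inE => /orP[/eqP -> | rF]; first by apply/negP.
    by move=> hra; case/negP: NF; apply/existsP; exists r; rewrite rF.
  split; apply/negP => H; apply: NV.
    by apply/existsP; exists s; rewrite setU11.
  by case/existsP: H => r /andP[rF hr]; apply/existsP; exists r; rewrite setU1r.
have leV : d`! * #|V| <= (d`!).-1 * #|U|.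
  by have := fact_gt0 d; move: (d`!) leUs => D; nia.
rewrite expnSr -mulnA; apply: leq_trans (leq_mul (leqnn _) leV) _.
by rewrite mulnCA expnS -mulnA leq_mul2l leU orbT.
Qed.

Lemma hitting_number_le (n d k : nat) :
  (d`!).-1 ^ k * n ^ d < d`! ^ k -> hitting_number n d <= k.
Proof.
move=> lt_k; have [F leFk leU] := greedy_cover n d k.
apply: leq_trans leFk; apply: (hitting_numberP n d).2.
apply/forallP => a; apply/implyP => ua; apply: contraT => Na.
move: (leq_ltn_trans leU lt_k); rewrite -[X in _ < X]muln1 ltn_mul2l => /andP[_].
by rewrite ltnS leqn0 cards_eq0 => /eqP/setP/(_ a); rewrite !inE ua Na.
Qed.

(** * Pigeonhole argument for the lower bound *)

Lemma uniq_extend (n d : nat) (u : seq 'I_n) :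
  uniq u -> size u <= d -> d <= n ->
  exists2 a : d.-tuple 'I_n, uniq a & prefix u a.
Proof.
move=> uu le_ud le_dn.
pose w := u ++ [seq x <- enum 'I_n | x \notin u].
have uw : uniq w.
  rewrite cat_uniq uu filter_uniq ?enum_uniq // andbT /=.
  by apply/hasPn => x; rewrite mem_filter => /andP[].
have sw : size w = n.
  rewrite -[RHS](size_enum_ord n); apply/perm_size/uniq_perm; rewrite ?enum_uniq //.
  by move=> x; rewrite mem_cat mem_filter mem_enum andbT orbN.
have sa : size (take d w) == d by rewrite size_takel ?sw.
exists (Tuple sa); first exact: take_uniq.
by apply/prefixP; exists (take (d - size u) [seq x <- enum 'I_n | x \notin u]);
  rewrite /= take_cat ltnNge le_ud.
Qed.

(* The indices [i * q + t] with [t < q] form the [i]-th block of schedules; in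
   that block [x_i] and [y_i] lie on the same side of [b], because there are
   only [2 ^ q] possible patterns of sides. *)
Lemma unseparated_pairs (n d m q : nat) (sch : nat -> 'S_n) (b : 'I_n) :
  m.*2 < d -> 2 ^ q + d < n ->
  exists x y : seq 'I_n,
    [/\ size x = m, size y = m, uniq (x ++ b :: y)
      & forall i t, i < m -> t < q ->
          before (sch (i * q + t)) (nth b x i) b
            = before (sch (i * q + t)) (nth b y i) b].
Proof.
move=> lt_md lt_n; elim: m lt_md => [|m IH] lt_md.
  by exists [::], [::].
have [|x [y [sx sy uxy Hxy]]] := IH; first by lia.
pose A := [set z | z \notin x ++ b :: y].
pose sig (z : 'I_n) : {ffun 'I_q -> bool} :=
  [ffun t : 'I_q => before (sch (m * q + t)) z b].
(* Fewer than [d] elements are in use so far, which is what the summand [d] in the bound on [n] pays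
   for. *)
have cardA : 2 ^ q < #|A|.
  have : #|A| + size (x ++ b :: y) = n.
    rewrite -(card_uniqP uxy) addnC -[RHS]card_ord -(cardC (mem (x ++ b :: y))).
    by congr (_ + _); apply: eq_card => z; rewrite !inE.
  by rewrite size_cat /= sx sy; lia.
have [f_inj|] := boolP (dinjectiveb sig (mem A)).
  have /card_in_imset : {in A &, injective sig} by apply/dinjectiveP.
  have := max_card (mem (sig @: A)); rewrite card_ffun card_bool card_ord.
  by move=> le_q eq_q; move: cardA; rewrite -eq_q ltnNge le_q.
case/dinjectivePn => x1 x1A [y1 /andP[/= y1x1 y1A] eq_sig].
exists (rcons x x1), (rcons y y1); rewrite !size_rcons sx sy; split=> //.
  have -> : uniq (rcons x x1 ++ b :: rcons y y1) = uniq [:: x1, y1 & x ++ b :: y].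
    by apply/perm_uniq/seq.permP => p; rewrite -!cats1 /= !count_cat /= count_cat /=; lia.
  move: x1A y1A; rewrite !inE /= inE negb_or => -> ->; rewrite uxy eq_sym.
  by rewrite y1x1.
move=> i t; rewrite ltnS leq_eqVlt => /orP[/eqP -> lt_tq | lt_im lt_tq].
  rewrite !nth_rcons sx sy ltnn eqxx.
  by have /ffunP/(_ (Ordinal lt_tq)) := eq_sig; rewrite !ffunE.
by rewrite !nth_rcons sx sy lt_im Hxy.
Qed.

Lemma hitting_card_ge (n d m : nat) (F : {set 'S_n}) :
  0 < m -> m.*2 < d -> d <= n -> hitting d F ->
  n <= 2 ^ (#|F| %/ m).+1 + d.
Proof.
move=> m_gt0 lt_md le_dn hitF; rewrite leqNgt; apply/negP => lt_n.
set q := (#|F| %/ m).+1 in lt_n.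
have n_gt0 : 0 < n by lia.
pose b : 'I_n := Ordinal n_gt0.
have [x [y [sx sy uxy Hxy]]] :=
  (* The default [1%g] only fills indices from [#|F|] on, which no member of [F] occupies. *)
  unseparated_pairs (fun j => nth 1%g (enum F) j) b lt_md lt_n.
have [|a ua /prefixP[w Ea]] := uniq_extend uxy _ le_dn.
  by rewrite size_cat /= sx sy; lia.
have /forallP/(_ a) := hitF; rewrite ua => /existsP[s /andP[sF]].
rewrite hitsE Ea -catA (sorted_pairwise (@before_trans n s)).
rewrite pairwise_cat => /and3P[/allrelP Hx _ /andP[/allP Hy _]].
pose j := index s (enum F).
have lt_jF : j < #|F| by rewrite cardE index_mem mem_enum.
have lt_im : j %/ q < m.
  by rewrite ltn_divLR //; apply: leq_trans lt_jF (ltnW _); rewrite mulnC ltn_ceil.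
(* The schedule [s] lies in block [j %/ q], so the pair of that block is not separated by [b],
   although hitting [a] puts [b] between its two elements. *)
have := Hxy _ _ lt_im (ltn_pmod j (ltn0Sn _)).
rewrite -divn_eq nth_index ?mem_enum // (Hx (nth b x (j %/ q)) b); first last.
- by rewrite mem_head.
- by rewrite mem_nth ?sx.
have : before s b (nth b y (j %/ q)) by apply: Hy; rewrite mem_cat mem_nth ?sy.
by rewrite /before /= => lt_by /esym; rewrite ltnNge (ltnW lt_by).
Qed.

(** * Passage to logarithms *)

Local Open Scope ring_scope.

Lemma ln2_gt0 (R : realType) : 0 < ln (2 : R).
Proof. by rewrite ln_gt0 // ltr1n. Qed.

(** The value [17 / 18] is chosen because [d! d >= 18] for [d >= 3]. It follows from
    [expR (17 / 36) >= 53 / 36], whose square exceeds 2. *)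
Lemma ln2_le (R : realType) : ln (2 : R) <= 17 / 18.
Proof.
rewrite -[leRHS]expRK ler_ln ?posrE ?expR_gt0 //.
have -> : 17 / 18 = 17 / 36 + 17 / 36 :> R by lra.
by rewrite expRD; have := expR_ge1Dx (17 / 36 : R); nra.
Qed.

Lemma hitting_number_ge_log (R : realType) (n d m : nat) :
  (0 < m)%N -> (m.*2 < d)%N -> (d <= n)%N ->
  m%:R * log2 n%:R - m%:R * (1 + log2 d.+1%:R) <= (hitting_number n d)%:R :> R.
Proof.
move=> m_gt0 lt_md le_dn.
have [[F hitF <-] _] := hitting_numberP n d.
have le_n : (n <= 2 ^ (#|F| %/ m).+1 * d.+1)%N.
  apply: leq_trans (hitting_card_ge m_gt0 lt_md le_dn hitF) _.
  by rewrite mulnS leq_add2l leq_pmull ?expn_gt0.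
have n_gt0 : (0 < n)%N by lia.
have m0 : 0 < m%:R :> R by rewrite ltr0n.
have l2 := ln2_gt0 R.
have le_ln : ln n%:R <= (#|F| %/ m).+1%:R * ln 2 + ln d.+1%:R :> R.
  rewrite mulr_natl -lnXn // -lnM ?posrE ?exprn_gt0 ?ltr0n //.
  rewrite ler_ln ?posrE ?mulr_gt0 ?exprn_gt0 ?ltr0n //.
  by rewrite -natrX -natrM ler_nat.
have le_log : log2 n%:R <= (#|F| %/ m).+1%:R + log2 d.+1%:R :> R.
  by rewrite /log2 ler_pdivrMr // mulrDl divfK ?gt_eqF.
have le_F : m%:R * (#|F| %/ m)%:R <= #|F|%:R :> R.
  by rewrite -natrM ler_nat mulnC leq_trunc_div.
by move: le_log le_F; rewrite -natr1; nra.
Qed.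

Lemma hitting_number_le_log (R : realType) (n d : nat) :
  (3 <= d)%N -> (d <= n)%N ->
  (hitting_number n d)%:R <= (d`!)%:R * d%:R * log2 n%:R :> R.
Proof.
move=> d_ge3 le_dn; set x := _ * _ * _.
have l2 := ln2_gt0 R; have l2' := ln2_le R.
have n0 : 0 < n%:R :> R by rewrite ltr0n; lia.
have l2n : ln 2 <= ln n%:R :> R by rewrite ler_ln ?posrE // ler_nat; lia.
have x_ge0 : 0 <= x by rewrite !mulr_ge0 ?ler0n ?invr_ge0 ?(ltW l2) //; lra.
have /andP[kx xk] := truncn_itv x_ge0; set k := Num.truncn x in kx xk.
apply: le_trans kx; rewrite ler_nat; apply: hitting_number_le.
set D := d`! in x x_ge0 k xk *.
have D_ge6 : (6 <= D)%N by apply: (@leq_fact 3).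
have D0 : 0 < D%:R :> R by rewrite ltr0n; lia.
have Dd18 : 18 <= D%:R * d%:R :> R by rewrite -natrM ler_nat; nia.
(* Truncation loses less than 1, while [x - x * ln 2 >= x / 18 >= 1]. *)
have lt_k : D%:R * d%:R * ln n%:R < k%:R :> R.
  have Ex : x * ln 2 = D%:R * d%:R * ln n%:R.
    by rewrite /x /log2 mulrA divfK ?gt_eqF.
  move: xk; rewrite -natr1 => xk.
  have : 18 * ln 2 <= x * ln 2 by rewrite Ex; nra.
  by rewrite ler_pM2r // => x18; rewrite -Ex; nra.
rewrite -(ltr_nat R) natrM !natrX.
have -> : D.-1%:R = D%:R * (1 - D%:R^-1) :> R.
  by rewrite mulrBr mulr1 mulfV ?gt_eqF // -subn1 natrB //; lia.
rewrite exprMn -mulrA gtr_pMr ?exprn_gt0 //.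
have le_exp : (1 - D%:R^-1) ^+ k <= expR (- (k%:R / D%:R)) :> R.
  rewrite -mulrN expRM_natl lerXn2r ?nnegrE ?expR_ge0 ?expR_ge1Dx //.
  by rewrite subr_ge0 invf_le1 // ler1n; lia.
apply: le_lt_trans (ler_wpM2r _ le_exp) _; first by rewrite exprn_ge0 // ltW.
rewrite -[n%:R]lnK ?posrE // -expRM_natl -expRD -[ltRHS]expR0 ltr_expR.
rewrite addrC subr_lt0 ltr_pdivlMr //.
by apply: le_lt_trans lt_k; rewrite mulrC mulrA.
Qed.

Theorem theorem1 (R : realType) :
  exists (g f : nat -> R),
    forall d : nat, (3 <= d)%N ->
      [/\ d%:R / (2 * log2 (d.+1)%:R) <= g d,
          f d <= (d`!)%:R * d%:R
        & exists C : R, forall n : nat, (d <= n)%N ->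
            g d * log2 n%:R - C <= (hitting_number n d)%:R /\
            (hitting_number n d)%:R <= f d * log2 n%:R].
Proof.
exists (fun d => (d.-1./2)%:R), (fun d => (d`!)%:R * d%:R) => d d_ge3.
have m_gt0 : (0 < d.-1./2)%N by lia.
split=> //.
  have log_ge2 : 2 <= log2 d.+1%:R :> R.
    rewrite /log2 ler_pdivlMr ?ln2_gt0 // mulr_natl -lnXn // -natrX.
    by rewrite ler_ln ?posrE ?ltr0n // ler_nat.
  (* Together with [log_ge2] this gives [d / (2 log (d + 1)) <= d / 4 <= m], where [m = d.-1./2]. *)
  have d_le : d%:R <= 4 * (d.-1./2)%:R :> R by rewrite -natrM ler_nat; lia.
  have m_ge0 := ler0n R d.-1./2.
  by rewrite ler_pdivrMr; nra.
exists ((d.-1./2)%:R * (1 + log2 d.+1%:R)) => n le_dn; split.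
  by apply: hitting_number_ge_log => //; lia.
exact: hitting_number_le_log.
Qed.
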